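(* The semigroups given by the semigroup presentations $$S = \langle a,b,c,e,x \mid axb = acx,\ ac = ca,\ xca = xe,\ ea = ae,\ aex = ax,\ xexb = bxex \rangle$$ and $$T = \langle a,b,c,d,e,x \mid axb = acx,\ ac = cd,\ xcd = xe,\ ed = ae,\ aex = ax,\ xexb = bxex \rangle$$ are both not LEF (not locally embeddable into the class of finite semigroups).
   Context: Maps are written on the right. A semigroup $S$ is called LEF if for every finite subset $H$ of $S$ there exist a finite semigroup $F_H$ and an injective function $f_H: H \to F_H$ such that for all $x,y \in H$ with $xy \in H$ we have $(xy)f_H = (xf_H)(yf_H)$. The presentations are semigroup presentations: each semigroup is the quotient of the free semigroup (nonempty words) on the generators by the congruence generated by the relations; the generator $e$ is not assumed to be idempotent or an identity. *)

(* Defs.v *)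
From HB Require Import structures.
From mathcomp Require Import all_boot.
From mathcomp Require Import finmap boolp.
Set Implicit Arguments.
Unset Strict Implicit.
Unset Printing Implicit Defensive.

Local Open Scope group_scope.
Local Open Scope quotient_scope.

#[short(type="finSemigroupType")]
HB.structure Definition FinSemigroup := {F of Finite F & Semigroup F}.

(* The function [f] is defined on the finite subset [H] only; [[` xyH]] is the
   product [x * y] seen as an element of [H]. *)
Definition LEF (S : semigroupType) : Prop :=
  forall H : {fset S}, exists (F : finSemigroupType) (f : H -> F),
    injective f /\
    forall (x y : H) (xyH : val x * val y \in H), f [` xyH]%fset = f x * f y.

Section FreeSemigroup.
Variable X : choiceType.

Record free_semigroup := FreeSemigroup {
  word :> seq X;
  _ : word != [::] }.

HB.instance Definition _ := [isSub for word].
HB.instance Definition _ := [Choice of free_semigroup by <:].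

Lemma free_mul_subproof (u v : free_semigroup) : word u ++ word v != [::].
Proof. by case: u => [[|x u] //= _]. Qed.

Definition free_mul (u v : free_semigroup) : free_semigroup :=
  FreeSemigroup (free_mul_subproof u v).

Lemma free_mulA : associative free_mul.
Proof. by move=> u v w; apply: val_inj; rewrite /= catA. Qed.

HB.instance Definition _ := isSemigroup.Build free_semigroup free_mulA.

Definition letter (x : X) : free_semigroup := @FreeSemigroup [:: x] isT.

End FreeSemigroup.

Section Presentation.
Variables (X : choiceType).
Implicit Type R : seq (free_semigroup X * free_semigroup X).

Inductive gen_cong R : free_semigroup X -> free_semigroup X -> Prop :=
| gen_cong_rel u v : (u, v) \in R -> gen_cong R u v
| gen_cong_refl u : gen_cong R u u
| gen_cong_sym u v : gen_cong R u v -> gen_cong R v u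
| gen_cong_trans u v w : gen_cong R u v -> gen_cong R v w -> gen_cong R u w
| gen_cong_mul u u' v v' :
    gen_cong R u u' -> gen_cong R v v' -> gen_cong R (u * v) (u' * v').

Definition gen_congb R : rel (free_semigroup X) := fun u v => `[< gen_cong R u v >].

Lemma gen_congb_equiv R : equiv_class_of (gen_congb R).
Proof.
split=> [u|u v|v u w].
- by apply/asboolP; exact: gen_cong_refl.
- by apply/asboolP/asboolP; exact: gen_cong_sym.
- by move=> /asboolP uv /asboolP vw; apply/asboolP; apply: gen_cong_trans uv vw.
Qed.

Canonical gen_cong_equiv R := EquivRelPack (gen_congb_equiv R).

Definition presented R : Type := {eq_quot gen_cong_equiv R}.

HB.instance Definition _ R := Choice.on (presented R).
HB.instance Definition _ R := EqQuotient.on (presented R).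

Lemma presented_eqP R (u v : free_semigroup X) :
  \pi_(presented R) u = \pi_(presented R) v <-> gen_cong R u v.
Proof.
split=> [/eqquotP/asboolP //|uv].
by apply/eqquotP; apply/asboolP.
Qed.

(* Well defined on classes by [pi_presented_mul]. *)
Definition presented_mul R (p q : presented R) : presented R :=
  \pi_(presented R) (repr p * repr q).

Lemma pi_presented_mul R (u v : free_semigroup X) :
  presented_mul (\pi_(presented R) u) (\pi_(presented R) v)
    = \pi_(presented R) (u * v).
Proof.
by apply/presented_eqP; apply: gen_cong_mul; apply/presented_eqP; rewrite reprK.
Qed.

Lemma presented_mulA R : associative (@presented_mul R).
Proof.
move=> p q r; rewrite -[p]reprK -[q]reprK -[r]reprK.
by rewrite !pi_presented_mul !reprK mulgA.
Qed.

HB.instance Definition _ R := isSemigroup.Build (presented R) (@presented_mulA R).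

Lemma pi_mulg R (u v : free_semigroup X) :
  \pi_(presented R) (u * v) = \pi_(presented R) u * \pi_(presented R) v.
Proof. by rewrite -pi_presented_mul. Qed.

End Presentation.

Inductive genS := Sa | Sb | Sc | Se | Sx.
Inductive genT := Ta | Tb | Tc | Td | Te | Tx.

Definition nat_of_genS (g : genS) : nat :=
  match g with Sa => 0 | Sb => 1 | Sc => 2 | Se => 3 | Sx => 4 end.
Definition genS_of_nat (n : nat) : genS := nth Sa [:: Sa; Sb; Sc; Se; Sx] n.
Lemma nat_of_genSK : cancel nat_of_genS genS_of_nat. Proof. by case. Qed.
HB.instance Definition _ := Choice.copy genS (can_type nat_of_genSK).

Definition nat_of_genT (g : genT) : nat :=
  match g with Ta => 0 | Tb => 1 | Tc => 2 | Td => 3 | Te => 4 | Tx => 5 end.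
Definition genT_of_nat (n : nat) : genT := nth Ta [:: Ta; Tb; Tc; Td; Te; Tx] n.
Lemma nat_of_genTK : cancel nat_of_genT genT_of_nat. Proof. by case. Qed.
HB.instance Definition _ := Choice.copy genT (can_type nat_of_genTK).

Definition relsS : seq (free_semigroup genS * free_semigroup genS) :=
  let a := letter Sa in let b := letter Sb in let c := letter Sc in
  let e := letter Se in let x := letter Sx in
  [:: (a * x * b, a * c * x);
      (a * c, c * a);
      (x * c * a, x * e);
      (e * a, a * e);
      (a * e * x, a * x);
      (x * e * x * b, b * x * e * x)].

Definition relsT : seq (free_semigroup genT * free_semigroup genT) :=
  let a := letter Ta in let b := letter Tb in let c := letter Tc in
  let d := letter Td in let e := letter Te in let x := letter Tx in
  [:: (a * x * b, a * c * x);
      (a * c, c * d);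
      (x * c * d, x * e);
      (e * d, a * e);
      (a * e * x, a * x);
      (x * e * x * b, b * x * e * x)].

(* Main.v *)
Require Import Defs.
From HB Require Import structures.
From mathcomp Require Import all_boot.
From mathcomp Require Import finmap ssralg ssrint.

(** In both semigroups (with d = a in S) one has x a^(n+1) x b = x a^n x for
    n >= 1 and x a x b = x e x, so x a x and x e x have b-roots of every order.
    In a finite semigroup right multiplication by b is injective on elements
    with b-roots of every order, so x a x b b = x e x b = b x e x = b x a x b
    forces x e x = x a x b = b x a x.  The relations have length at most 4, so a
    local embedding into a finite semigroup transports this equality back.
    It fails in S and T: the words b x W x b^j with W over {a, c, d, e} and
    #a + #d - #c - j = 1 form a union of congruence classes, because the
    relation x e x b = b x e x never applies to them; the automaton [step]
    recognises these words. *)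

Set Implicit Arguments.
Unset Strict Implicit.
Unset Printing Implicit Defensive.

Local Open Scope group_scope.
Local Open Scope quotient_scope.

(** Elements outside [s] are sent to the image of [y0], which makes [g] total. *)
Lemma LEF_seq (G : semigroupType) (y0 : G) (s : seq G) :
  LEF G -> y0 \in s ->
  exists (F : finSemigroupType) (g : G -> F), {in s &, injective g} /\
    {in s &, forall y z, y * z \in s -> g (y * z) = g y * g z}.
Proof.
move=> lefG s0; have [F [f [f_inj fM]]] := lefG (seq_fset tt s).
have inH y : (y \in seq_fset tt s) = (y \in s) by rewrite seq_fsetE.
have H0 : y0 \in seq_fset tt s by rewrite inH.
exists F, (fun y => f (insubd [` H0]%fset y)).
have gE y (Hy : y \in seq_fset tt s) :
    insubd [` H0]%fset y = [` Hy]%fset.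
  by apply: val_inj; rewrite val_insubd Hy.
split=> [y z|y z]; rewrite -!inH => Hy Hz.
  by rewrite !gE => /f_inj/(congr1 val).
by move=> Hyz; rewrite !gE -fM.
Qed.

(** Pigeonhole: there are only finitely many maps from [T] to itself. *)
Lemma iter_eventually_periodic (T : finType) (r : T -> T) :
  exists i k, iter i r =1 iter (k.+1 + i) r.
Proof.
pose h (i : 'I_(#|{ffun T -> T}|.+1)) := [ffun z => iter i r z].
have /injectivePn [i [j neq_ij hij]] : ~~ injectiveb h.
  by apply/injectiveP => /leq_card; rewrite card_ord ltnn.
have iter_ij z : iter i r z = iter j r z by move/ffunP/(_ z): hij; rewrite !ffunE.
case: (ltngtP i j) => [lt_ij|lt_ji|/val_inj eq_ij]; last first.
- by rewrite eq_ij eqxx in neq_ij.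
- by exists j, (i - j.+1) => z; rewrite -iter_ij addSnnS subnK.
- by exists i, (j - i.+1) => z; rewrite iter_ij addSnnS subnK.
Qed.

(** On the image of [iter i r], the map [iter k r] is a left inverse of [r]. *)
Lemma stable_image_inj (T : finType) (r : T -> T) (u v : T) :
  (forall n, exists u', u = iter n r u') ->
  (forall n, exists v', v = iter n r v') ->
  r u = r v -> u = v.
Proof.
have [i [k per]] := iter_eventually_periodic r => iu iv ruv.
have fixed w : (exists w', w = iter i r w') -> w = iter k r (r w).
  by case=> w' ->; rewrite -iterSr -iterD.
by rewrite (fixed u) // (fixed v) // ruv.
Qed.

Definition relations (G : semigroupType) (a b c d e x : G) : Prop :=
  [/\ a * x * b = a * c * x, a * c = c * d, x * c * d = x * e &
  [/\ e * d = a * e, a * e * x = a * x & x * e * x * b = b * x * e * x]].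

Section Roots.
Variables (G : semigroupType) (a b c d e x : G).
Hypothesis rels : relations a b c d e x.

Definition xa n : G := iter n (fun y => y * a) x.

Lemma xaS n : xa n.+1 = xa n * a.
Proof. by []. Qed.

(** The last [a * c] becomes [c * d], induction turns [c] into [e], and [e * d = a * e] restores the
    [a]. *)
Lemma xaS_c n : xa n.+1 * c = xa n * e.
Proof.
case: rels => _ ac xcd [ed _ _].
elim: n => [|n IHn]; first by rewrite /= -mulgA ac mulgA.
by rewrite xaS -mulgA ac mulgA IHn -mulgA ed mulgA.
Qed.

Lemma xaSx_b n : xa n.+1 * x * b = xa n * e * x.
Proof.
case: rels => axb _ _ _.
by rewrite -xaS_c xaS -!(mulgA (xa n)) axb !mulgA.
Qed.

Lemma xaSSx_b n : xa n.+2 * x * b = xa n.+1 * x.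
Proof.
case: rels => _ _ _ [_ aex _].
by rewrite xaSx_b xaS -!(mulgA (xa n)) aex.
Qed.

Lemma xax_root n : x * a * x = iter n (fun y => y * b) (xa n.+1 * x).
Proof. by elim: n => // n ->; rewrite iterSr xaSSx_b. Qed.

End Roots.

Lemma relations_fin (F : finSemigroupType) (a b c d e x : F) :
  relations a b c d e x -> x * e * x = b * x * a * x.
Proof.
move=> rels; have [_ _ _ [_ _ xexb]] := rels.
have xaxb : x * a * x * b = x * e * x := xaSx_b rels 0.
apply: (@stable_image_inj _ (fun y => y * b)) => [n|n|].
- exists (xa a x n.+1 * x * b).
  by rewrite -xaxb (xax_root rels n) -iterSr.
(* Left and right multiplications commute, so [b] times a root of [x * a * x] is a root of
   [b * x * a * x]. *)
- exists (b * (xa a x n.+1 * x)); rewrite -2!mulgA (mulgA x) (xax_root rels n).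
  by elim: n (_ * x) => //= m IHm z; rewrite mulgA IHm.
- by rewrite xexb -!(mulgA b) -xaxb.
Qed.

Lemma relations_LEF (G : semigroupType) (a b c d e x : G) :
  relations a b c d e x -> LEF G -> x * e * x = b * x * a * x.
Proof.
case=> axb ac xcd [ed aex xexb] lefG.
(* The letters and all prefixes of the words involved, so that left-bracketed products never leave
   [s]. *)
pose s := [:: a; b; c; d; e; x; a * x; a * x * b; a * c; a * c * x; c * d;
  x * c; x * c * d; x * e; e * d; a * e; a * e * x; x * e * x; x * e * x * b;
  b * x; b * x * e; b * x * e * x; b * x * a; b * x * a * x].
have [|F [g [g_inj gM]]] := @LEF_seq G a s lefG; first by rewrite mem_head.
have sM y z : [&& y \in s, z \in s & y * z \in s] -> g (y * z) = g y * g z.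
  by case/and3P=> *; exact: gM.
apply: g_inj; [by rewrite !inE eqxx ?orbT.. |].
rewrite !sM ?inE ?eqxx ?orbT //.
apply: (@relations_fin F _ _ (g c) (g d)).
by split; [| | |split]; rewrite -!sM ?(inE, eqxx, orbT) //; congr (g _).
Qed.

(* [Inner n]: after b x W with #a + #d - #c = n in W.
   [Outer k]: after b x W x b^j with #a + #d - #c - j = k + 1. *)
Inductive state := Start | AfterB | Inner of int | Outer of nat | Dead.

(** Balance 0 has to be dead: from [Start], [b * x * e * x] reaches balance 0, while [x * e * x * b]
    dies at once. *)
Definition outer (n : int) : state := if n is Posz k.+1 then Outer k else Dead.

Definition step (q : state) (g : genT) : state :=
  match q, g with
  | Start, Tb => AfterB
  | AfterB, Tx => Inner 0
  | Inner n, (Ta | Td) => Inner (n + 1)%R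
  | Inner n, Tc => Inner (n - 1)%R
  | Inner n, Te => Inner n
  | Inner n, Tx => outer n
  | Outer k, Tb => outer k
  | _, _ => Dead
  end.

(** Acting equally on all states is a congruence on words; it contains [R], hence the congruence
    generated by [R]. *)
Lemma gen_cong_foldl (X : choiceType) (Q : Type) (act : Q -> X -> Q)
    (R : seq (free_semigroup X * free_semigroup X)) (u v : free_semigroup X) :
  (forall l r, (l, r) \in R ->
     forall q, foldl act q (word l) = foldl act q (word r)) ->
  gen_cong R u v -> forall q, foldl act q (word u) = foldl act q (word v).
Proof.
move=> actR; elim=> {u v} [u v /actR //|//|u v _ IH q|u v w _ IHu _ IHv q|].
- by rewrite IH.
- by rewrite IHu IHv.
- by move=> u u' v v' _ IHu _ IHv q; rewrite !foldl_cat IHu IHv.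
Qed.

(** [Ta] and [Td] have the same transitions, so the same automaton serves S, where [a] plays both
    parts. *)
Definition genT_of_genS (g : genS) : genT :=
  match g with Sa => Ta | Sb => Tb | Sc => Tc | Se => Te | Sx => Tx end.

Lemma step_outer_b n : step (outer (n + 1)%R) Tb = outer n.
Proof. by case: n => [n|[|n]] //=; rewrite addn1. Qed.

Lemma step_outer_dead n g : g <> Tb -> step (outer n) g = Dead.
Proof. by case: n => [[|n]|n] //; case: g. Qed.

(** In [a * x * b = a * c * x], a [b] after the closing [x] lowers the balance just as a [c] before
    it does. *)
Lemma step_relsT l r : (l, r) \in relsT ->
  forall q, foldl step q (word l) = foldl step q (word r).
Proof.
rewrite !inE => /or4P[|||/or3P[]] /eqP[-> ->] [||n|[|k]|] //=;
  by rewrite ?step_outer_b ?step_outer_dead ?GRing.addrK ?GRing.subrK.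
Qed.

Lemma step_relsS l r : (l, r) \in relsS -> forall q,
  foldl (fun q g => step q (genT_of_genS g)) q (word l) =
  foldl (fun q g => step q (genT_of_genS g)) q (word r).
Proof.
rewrite !inE => /or4P[|||/or3P[]] /eqP[-> ->] [||n|[|k]|] //=;
  by rewrite ?step_outer_b ?step_outer_dead ?GRing.addrK ?GRing.subrK.
Qed.

Lemma all_rels_pi (X : choiceType)
    (R : seq (free_semigroup X * free_semigroup X)) :
  all (fun p => \pi_(presented R) p.1 == \pi_(presented R) p.2) R.
Proof.
by apply/allP => -[l r] lr; apply/eqP/presented_eqP; exact: gen_cong_rel.
Qed.

Lemma relationsT : relations (\pi_(presented relsT) (letter Ta))
  (\pi_(presented relsT) (letter Tb)) (\pi_(presented relsT) (letter Tc))
  (\pi_(presented relsT) (letter Td)) (\pi_(presented relsT) (letter Te))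
  (\pi_(presented relsT) (letter Tx)).
Proof.
have := all_rels_pi relsT; rewrite /= !pi_mulg.
by case/and5P=> /eqP ? /eqP ? /eqP ? /eqP ? /and3P[/eqP ? /eqP ? _].
Qed.

Lemma relationsS : relations (\pi_(presented relsS) (letter Sa))
  (\pi_(presented relsS) (letter Sb)) (\pi_(presented relsS) (letter Sc))
  (\pi_(presented relsS) (letter Sa)) (\pi_(presented relsS) (letter Se))
  (\pi_(presented relsS) (letter Sx)).
Proof.
have := all_rels_pi relsS; rewrite /= !pi_mulg.
by case/and5P=> /eqP ? /eqP ? /eqP ? /eqP ? /and3P[/eqP ? /eqP ? _].
Qed.

Theorem proposition12 : ~ LEF (presented relsS) /\ ~ LEF (presented relsT).
Proof.
split=> lefG.
(* From [Start] the left word leads to [Dead], the right one to [Outer 0]. *)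
- have /presented_eqP/(gen_cong_foldl step_relsS)/(_ Start) // :
    \pi_(presented relsS) (letter Sx * letter Se * letter Sx) =
    \pi_(presented relsS) (letter Sb * letter Sx * letter Sa * letter Sx).
  by rewrite !pi_mulg; exact: relations_LEF relationsS lefG.
- have /presented_eqP/(gen_cong_foldl step_relsT)/(_ Start) // :
    \pi_(presented relsT) (letter Tx * letter Te * letter Tx) =
    \pi_(presented relsT) (letter Tb * letter Tx * letter Ta * letter Tx).
  by rewrite !pi_mulg; exact: relations_LEF relationsT lefG.
Qed.
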